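(* Let $R$ be a $G$-graded ring, let $M$ be a graded $R$-module and let $K_1,K_2$ be two graded $R$-submodules of $M$. If $K_1$ is a graded essential $R$-submodule of $M$ and $K_2$ is a graded semi-essential $R$-submodule of $M$, then $K_1\cap K_2$ is a graded semi-essential $R$-submodule of $M$.
   Context: $G$ is a group; a ring $R$ with unity is $G$-graded if $R=\bigoplus_{g\in G}R_g$ for additive subgroups with $R_gR_h\subseteq R_{gh}$; a left $R$-module $M$ is graded if $M=\bigoplus_{g\in G}M_g$ for additive subgroups with $R_gM_h\subseteq M_{gh}$. $h(R)=\bigcup_g R_g$, $h(M)=\bigcup_g M_g$. A submodule $N$ of $M$ is graded if $N=\bigoplus_{g}(N\cap M_g)$. $(N:_RM)=\{r\in R: rM\subseteq N\}$. A proper graded submodule $P$ of $M$ is graded prime if whenever $r\in h(R)$, $m\in h(M)$ and $rm\in P$, then $m\in P$ or $r\in(P:_RM)$. A nonzero graded submodule $K$ of $M$ is graded essential if $K\cap N\neq\{0\}$ for every nonzero graded submodule $N$ of $M$. A nonzero graded submodule $K$ of $M$ is graded semi-essential if $K\cap P\neq\{0\}$ for every nonzero graded prime submodule $P$ of $M$. *)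

(* Defs.v *)
From mathcomp Require Import all_boot all_algebra.
From mathcomp Require Import mathcomp_extra boolp classical_sets functions.
From mathcomp Require Import cardinality fsbigop.

Set Implicit Arguments.
Unset Strict Implicit.
Unset Printing Implicit Defensive.

Import GRing.Theory.
Local Open Scope classical_set_scope.
Local Open Scope ring_scope.

(* Internal direct sum A = \bigoplus_i F i of a possibly infinite family of
   subgroups.  The finiteness condition is needed: the sum over [set: I] is 0
   by convention when infinitely many terms are nonzero. *)
Definition is_direct_sum (I : choiceType) (V : zmodType) (A : set V)
    (F : I -> set V) : Prop :=
  (forall i, F i `<=` A) /\
  forall x, A x -> exists! f : I -> V,
    [/\ forall i, F i (f i),
        finite_set [set i | f i <> 0] &
        x = \sum_(i \in [set: I]) f i].

(* Homogeneous elements: h(R) and h(M). *)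
Definition homogeneous (I : choiceType) (V : zmodType) (F : I -> set V) :
  set V := \bigcup_i F i.

Definition graded_ring (G : groupType) (R : pzRingType) (RG : G -> set R) :
    Prop :=
  [/\ forall g, zmod_closed [in RG g],
      is_direct_sum [set: R] RG &
      forall g h r s, RG g r -> RG h s -> RG (g * h)%g (r * s)].

Definition graded_module (G : groupType) (R : pzRingType) (RG : G -> set R)
    (M : lmodType R) (MG : G -> set M) : Prop :=
  [/\ forall g, zmod_closed [in MG g],
      is_direct_sum [set: M] MG &
      forall g h r m, RG g r -> MG h m -> MG (g * h)%g (r *: m)].

Definition graded_submodule (G : groupType) (R : pzRingType)
    (M : lmodType R) (MG : G -> set M) (N : set M) : Prop :=
  submod_closed [in N] /\ is_direct_sum N (fun g => N `&` MG g).

(* The residual (N :_R M). *)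
Definition residual (R : pzRingType) (M : lmodType R) (N : set M) : set R :=
  [set r | forall m : M, N (r *: m)].

Definition graded_prime (G : groupType) (R : pzRingType) (RG : G -> set R)
    (M : lmodType R) (MG : G -> set M) (P : set M) : Prop :=
  [/\ graded_submodule MG P,
      P <> [set: M] &
      forall r m, homogeneous RG r -> homogeneous MG m ->
        P (r *: m) -> P m \/ residual P r].

Definition graded_essential (G : groupType) (R : pzRingType)
    (M : lmodType R) (MG : G -> set M) (K : set M) : Prop :=
  [/\ graded_submodule MG K,
      K <> [set 0] &
      forall N, graded_submodule MG N -> N <> [set 0] ->
        K `&` N <> [set 0]].

Definition graded_semi_essential (G : groupType) (R : pzRingType)
    (RG : G -> set R) (M : lmodType R) (MG : G -> set M) (K : set M) : Prop :=
  [/\ graded_submodule MG K,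
      K <> [set 0] &
      forall P, graded_prime RG MG P -> P <> [set 0] ->
        K `&` P <> [set 0]].

(* Main.v *)
Require Import Defs.
From mathcomp Require Import all_boot all_algebra.
From mathcomp Require Import classical_sets.

Local Open Scope classical_set_scope.

(** For a nonzero graded prime [P], semi-essentiality gives [K2]&[P] nonzero. This intersection need
    not be prime, but it is a graded submodule, which is all that essentiality of [K1] asks of it;
    so [K1] meets it nontrivially. The supporting fact is [graded_submoduleI]: graded submodules are
    stable under intersection. *)

Lemma submod_closedI {R : pzRingType} {M : lmodType R} {N1 N2 : set M} :
  GRing.submod_closed [in N1] -> GRing.submod_closed [in N2] ->
  GRing.submod_closed [in N1 `&` N2].
Proof.
move=> [N1_0 N1_lin] [N2_0 N2_lin]; split; first by rewrite in_setI N1_0.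
move=> a u v; rewrite !in_setI => /andP[u1 u2] /andP[v1 v2].
by rewrite N1_lin ?N2_lin.
Qed.

(* The components of [x] in [N1] and in [N2] are both its components in [M]. *)
Lemma graded_submoduleI {G : groupType} {R : pzRingType} {M : lmodType R}
    {MG : G -> set M} {N1 N2 : set M} :
  is_direct_sum [set: M] MG ->
  graded_submodule MG N1 -> graded_submodule MG N2 ->
  graded_submodule MG (N1 `&` N2).
Proof.
move=> [_ dM] [subN1 [_ dN1]] [subN2 [_ dN2]].
split; first exact: submod_closedI.
split=> [g y []//|x [x1 x2]].
have [f [_ f_uniq]] := dM x I.
have [f1 [[f1N f1fin f1x] _]] := dN1 x x1.
have [f2 [[f2N f2fin f2x] _]] := dN2 x x2.
have ff1 : f = f1 by apply: f_uniq; split=> // g; case: (f1N g).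
have ff2 : f = f2 by apply: f_uniq; split=> // g; case: (f2N g).
exists f; split.
  rewrite -ff1 in f1N f1fin f1x; rewrite -ff2 in f2N.
  by split=> // g; have [? ?] := f1N g; have [? _] := f2N g.
(* A decomposition inside the intersection is also one in [M], so uniqueness is inherited. *)
by move=> f' [f'N f'fin f'x]; apply: f_uniq; split=> // g; case: (f'N g).
Qed.

Theorem proposition5p8 (G : groupType)
  (R : pzRingType) (RG : G -> set R) (hR : graded_ring RG)
  (M : lmodType R) (MG : G -> set M) (hM : graded_module RG MG)
  (K1 K2 : set M)
  (hK1 : graded_submodule MG K1) (hK2 : graded_submodule MG K2)
  (hK1ess : graded_essential MG K1)
  (hK2semi : graded_semi_essential RG MG K2) :
  graded_semi_essential RG MG (K1 `&` K2).
Proof.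
have [_ dM _] := hM.
have [_ _ K1ess] := hK1ess; have [_ K2nz K2semi] := hK2semi.
(* [K1]&[K2] is nonzero by essentiality of [K1] tested on [K2] itself. *)
split; [exact: graded_submoduleI | exact: K1ess |].
move=> P primeP Pnz; have [gradedP _ _] := primeP.
(* Regrouped as [K1]&[(K2]&[P)], so that [K1] is tested on [K2]&[P]. *)
rewrite -setIA; apply: K1ess; first exact: graded_submoduleI.
exact: K2semi.
Qed.
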